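(* Let $1\le q=p<r<\infty$, $\lambda_0>0$, $\lambda_j\ge0$, $j=1,\ldots,n$, put $\sigma_r(t)=\sum_{j=1}^n\lambda_j|\varphi_j(t)|^r$, and assume $\sigma_r(t)\ne0$ for almost all $t\in T$. Let $$\widehat x(t)=\begin{cases}\left(pr^{-1}\sigma_r^{-1}(t)(|\psi(t)|^p-\lambda_0)_+\right)^{\frac1{r-p}},&t\in T_0,\\ \left(pr^{-1}\sigma_r^{-1}(t)|\psi(t)|^p\right)^{\frac1{r-p}},&t\in T\setminus T_0,\end{cases}$$ and suppose that $(\lambda_0,\ldots,\lambda_n)$ satisfies $$\int_{T_0}\widehat x^p(t)\,d\mu(t)\le\delta^p,\qquad \int_T|\varphi_j(t)|^r\widehat x^r(t)\,d\mu(t)\le1,\quad j=1,\ldots,n,$$ $$\lambda_0\Bigl(\int_{T_0}\widehat x^p(t)\,d\mu(t)-\delta^p\Bigr)=0,\qquad \lambda_j\Bigl(\int_T|\varphi_j(t)|^r\widehat x^r(t)\,d\mu(t)-1\Bigr)=0,\quad j=1,\ldots,n.$$ Then $$E(p,p,r)=\Bigl(\lambda_0\delta^p+\frac rp\sum_{j=1}^n\lambda_j\Bigr)^{1/p},$$ and the method $$\widehat m(y)(t)=\begin{cases}\alpha(t)\psi(t)y(t),&t\in T_0,\\ 0,&t\in T\setminus T_0,\end{cases}\qquad \alpha(t)=\begin{cases}\min\{1,\lambda_0|\psi(t)|^{-p}\},&t\in T_0,\ \psi(t)\ne0,\\ 0,&\text{otherwise},\end{cases}$$ is optimal.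
   Context: $a_+=\max\{a,0\}$. $(T,\Sigma,\mu)$ is a nonempty set with a $\sigma$-algebra $\Sigma$ and a nonnegative $\sigma$-additive measure $\mu$; $L_p(T,\mu)$ denotes the $\Sigma$-measurable functions with values in $\mathbb R$ or $\mathbb C$ with finite norm $\|x\|_{L_p(T,\mu)}=(\int_T|x|^p\,d\mu)^{1/p}$ (essential supremum for $p=\infty$). $T_0\subset T$ is a nonempty $\mu$-measurable subset, $\psi,\varphi_1,\ldots,\varphi_n$ are measurable functions on $T$, and $\delta>0$. Put $$\mathcal W=\{x:\ x\in L_p(T_0,\mu),\ \|\varphi_jx\|_{L_r(T,\mu)}<\infty,\ j=1,\ldots,n\},\quad W=\{x\in\mathcal W:\ \|\varphi_jx\|_{L_r(T,\mu)}\le1,\ j=1,\ldots,n\}$$ (here $x$ is a measurable function on $T$). It is assumed that $\Lambda x:=\psi x\in L_q(T,\mu)$ for all $x\in\mathcal W$. A recovery method is an arbitrary map $m\colon L_p(T_0,\mu)\to L_q(T,\mu)$; its error is $$e(p,q,r,m)=\sup\{\|\Lambda x-m(y)\|_{L_q(T,\mu)}:\ x\in W,\ y\in L_p(T_0,\mu),\ \|x-y\|_{L_p(T_0,\mu)}\le\delta\}.$$ The optimal recovery error is $E(p,q,r)=\inf_m e(p,q,r,m)$ over all methods $m$, and a method attaining this infimum is called optimal. Here $q=p$. *)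

(* Defs.v *)
From HB Require Import structures.
From mathcomp Require Import all_boot all_order all_algebra.
From mathcomp Require Import all_classical all_reals all_analysis.
From mathcomp Require Import complex.

Set Implicit Arguments.
Unset Strict Implicit.
Unset Printing Implicit Defensive.
Import Order.TTheory GRing.Theory Num.Theory.
Import numFieldNormedType.Exports.

Local Open Scope classical_set_scope.
Local Open Scope ring_scope.

Variant scalar_kind := RealScalars | ComplexScalars.

Section scalars.
Context {R : realType}.

Definition scalar_field (k : scalar_kind) : numFieldType :=
  match k with
  | RealScalars => R : numFieldType
  | ComplexScalars => (complex R : numFieldType)
  end.

(* The norm of the numFieldType R[i] takes values in R[i]; this is the
   R-valued absolute value. *)
Definition modulus (k : scalar_kind) : scalar_field k -> R :=
  match k with
  | RealScalars => fun z => `|z|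
  | ComplexScalars => fun z => ComplexField.Normc.normc z
  end.

Definition of_real (k : scalar_kind) : R -> scalar_field k :=
  match k with
  | RealScalars => fun a => a
  | ComplexScalars => fun a => real_complex R a
  end.

(* Complex-valued functions are measurable when their real and imaginary
   parts are. *)
Definition scalar_measurable {d : measure_display} {T : measurableType d}
    (k : scalar_kind) (D : set T) : (T -> scalar_field k) -> Prop :=
  match k with
  | RealScalars => fun x => measurable_fun D x
  | ComplexScalars => fun x =>
      measurable_fun D (fun t => complex.Re (x t)) /\
      measurable_fun D (fun t => complex.Im (x t))
  end.

End scalars.

Arguments scalar_field : clear implicits.

Section recovery.
Context {d : measure_display} {T : measurableType d} {R : realType}.
Variables (k : scalar_kind) (mu : {measure set T -> \bar R}).
Local Notation K := (scalar_field R k).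
Implicit Types (p q r : \bar R) (D : set T) (x y : T -> K).

Definition Lp_norm p D x : \bar R :=
  Lnorm mu p ((fun t => (modulus (x t))%:E) \_ D).

(* Functions on D are represented by functions on T whose values off D are
   irrelevant. *)
Definition Lp p D x : Prop :=
  scalar_measurable D x /\ (Lp_norm p D x < +oo)%E.

Variables (T0 : set T) (n : nat) (phi : 'I_n -> T -> K).

Definition calW p r : set (T -> K) :=
  [set x | [/\ scalar_measurable setT x, Lp p T0 x &
    forall j, (Lp_norm r setT (fun t => phi j t * x t)%R < +oo)%E]].

Definition classW p r : set (T -> K) :=
  [set x | calW p r x /\
    forall j, (Lp_norm r setT (fun t => phi j t * x t)%R <= 1)%E].

(* The second condition says that m factors through restriction to T0, so
   that m is a map defined on functions on T0. *)
Definition recovery_method p q (m : (T -> K) -> (T -> K)) : Prop :=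
  (forall y, Lp p T0 y -> Lp q setT (m y)) /\
  (forall y1 y2, Lp p T0 y1 -> Lp p T0 y2 ->
    (forall t, T0 t -> y1 t = y2 t) -> m y1 = m y2).

Variables (psi : T -> K) (delta : R).

Definition method_error p q r (m : (T -> K) -> (T -> K)) : \bar R :=
  ereal_sup [set v | exists x y,
    [/\ classW p r x, Lp p T0 y,
        (Lp_norm p T0 (fun t => x t - y t)%R <= delta%:E)%E &
        v = Lp_norm q setT (fun t => psi t * x t - m y t)]].

Definition optimal_error p q r : \bar R :=
  ereal_inf [set method_error p q r m | m in recovery_method p q].

Definition optimal_method p q r (m : (T -> K) -> (T -> K)) : Prop :=
  recovery_method p q m /\ method_error p q r m = optimal_error p q r.

End recovery.

Section extremal.
Context {d : measure_display} {T : measurableType d} {R : realType}.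
Variables (k : scalar_kind) (T0 : set T) (n : nat).
Local Notation K := (scalar_field R k).
Variables (phi : 'I_n -> T -> K) (psi : T -> K) (p r : R).
Variables (lambda0 : R) (lambda : 'I_n -> R).

Definition sigma_r (t : T) : R :=
  \sum_(j < n) lambda j * modulus (phi j t) `^ r.

Definition xhat (t : T) : R :=
  (p * r^-1 * (sigma_r t)^-1 *
    (if t \in T0 then Num.max (modulus (psi t) `^ p - lambda0) 0
     else modulus (psi t) `^ p)) `^ (r - p)^-1.

Definition alpha (t : T) : R :=
  if (t \in T0) && (psi t != 0)
  then Num.min 1 (lambda0 * modulus (psi t) `^ (- p)) else 0.

Definition mhat (y : T -> K) (t : T) : K :=
  if t \in T0 then of_real k (alpha t) * psi t * y t else 0.

End extremal.

(* Main.v *)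
Require Import Defs.
From HB Require Import structures.
From mathcomp Require Import all_boot all_order all_algebra.
From mathcomp Require Import all_classical all_reals all_analysis.
From mathcomp Require Import measurable_realfun complex ring lra.

Set Implicit Arguments.
Unset Strict Implicit.
Unset Printing Implicit Defensive.
Import Order.TTheory GRing.Theory Num.Theory.
Import numFieldNormedType.Exports.

Local Open Scope classical_set_scope.
Local Open Scope ring_scope.

(** The function [xhat] lies in [W] with data norm at most [delta], so both
[xhat] and [- xhat] are compatible with the data [0] and the optimal error is at
least [|psi xhat|_p]. Where [sigma != 0], one has
[|psi xhat|^p = 1_T0 lambda0 xhat^p + (r/p) sigma xhat^r], and complementary
slackness turns the integral of the right-hand side into
[lambda0 delta^p + (r/p) sum_j lambda_j].

For the upper bound, write [x - alpha y = (1 - alpha) x + alpha (x - y)] on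
[T0]; convexity of [u^p] bounds [|psi x - mhat y|^p] by
[1_T0 lambda0 |x - y|^p + g |x|^p], where [g = (r/p) sigma xhat^(r-p)] is
[(|psi|^p - lambda0)_+] on [T0] and [|psi|^p] off [T0]. Young's inequality gives
[g |x|^p <= ((r-p)/p) sigma xhat^r + sigma |x|^r], and integrating with the
constraints on [x] and [xhat] recovers the same value. *)

(** * Absolute values of real or complex scalars *)

Section scalar_lemmas.
Context {R : realType} (k : scalar_kind).
Local Notation K := (scalar_field R k).
Implicit Types z w : K.

Lemma modulus_ge0 z : 0 <= modulus z.
Proof. by case: k z => /= [z|[a b]]; [exact: normr_ge0|exact: sqrtr_ge0]. Qed.

Lemma modulus0 : modulus (0 : K) = 0.
Proof. by case: k; [exact: normr0|exact: ComplexField.Normc.normc0]. Qed.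

Lemma modulusM z w : modulus (z * w) = modulus z * modulus w.
Proof.
by case: k z w => z w; [exact: normrM|exact: ComplexField.Normc.normcM].
Qed.

Lemma modulusN z : modulus (- z) = modulus z.
Proof. by case: k z => z; [exact: normrN|exact: normcN]. Qed.

Lemma modulusMn z n : modulus (z *+ n) = modulus z *+ n.
Proof. by case: k z => z; [exact: normrMn|exact: normcMn]. Qed.

Lemma le_modulusD z w : modulus (z + w) <= modulus z + modulus w.
Proof. by case: k z w => z w; [exact: ler_normD|exact: le_normcD]. Qed.

Lemma modulus_of_real (a : R) : modulus (of_real k a) = `|a|.
Proof. by case: k => //=; rewrite expr0n addr0 sqrtr_sqr. Qed.

Lemma of_realB (a b : R) : of_real k (a - b) = of_real k a - of_real k b.
Proof. by case: k => //=; rewrite rmorphB. Qed.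

Lemma of_real1 : of_real k (1 : R) = 1.
Proof. by case: k. Qed.

End scalar_lemmas.

(** * Measurability of scalar-valued functions *)

Section scalar_measurability.
Context {d : measure_display} {T : measurableType d} {R : realType}.
Variable k : scalar_kind.
Local Notation K := (scalar_field R k).
Implicit Types (x y : T -> K) (D : set T).

Lemma measurable_modulus D x : scalar_measurable D x ->
  measurable_fun D (fun t => modulus (x t)).
Proof.
case: k x => x /= => [mx|[mre mim]]; first exact: measurableT_comp.
(* The complex modulus is written as a real power with exponent 1/2, so that measurability of real
   powers applies. *)
rewrite [X in measurable_fun D X](_ : _ = fun t =>
    (complex.Re (x t) ^+ 2 + complex.Im (x t) ^+ 2) `^ 2^-1); last first.
  apply/funext => t; rewrite powR12_sqrt ?addr_ge0 ?sqr_ge0//.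
  by case: (x t).
apply: (measurableT_comp (measurable_powR _)).
by apply: measurable_funD; exact: measurable_funX.
Qed.

Lemma scalar_measurableM D x y : scalar_measurable D x ->
  scalar_measurable D y -> scalar_measurable D (fun t => x t * y t).
Proof.
case: k x y => x y /= => [|[xr xi] [yr yi]]; first exact: measurable_funM.
split.
  rewrite [X in measurable_fun D X](_ : _ = fun t =>
    complex.Re (x t) * complex.Re (y t) - complex.Im (x t) * complex.Im (y t)).
    by apply: measurable_funB; exact: measurable_funM.
  by apply/funext => t; case: (x t) (y t) => [a b] [c e].
rewrite [X in measurable_fun D X](_ : _ = fun t =>
    complex.Re (x t) * complex.Im (y t) + complex.Im (x t) * complex.Re (y t)).
  by apply: measurable_funD; exact: measurable_funM.
by apply/funext => t; case: (x t) (y t) => [a b] [c e].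
Qed.

Lemma scalar_measurableN D x : scalar_measurable D x ->
  scalar_measurable D (fun t => - x t).
Proof.
case: k x => x /= => [|[xr xi]]; first exact: measurable_funN.
split.
  rewrite [X in measurable_fun D X](_ : _ = fun t => - complex.Re (x t)).
    exact: measurable_funN.
  by apply/funext => t; case: (x t).
rewrite [X in measurable_fun D X](_ : _ = fun t => - complex.Im (x t)).
  exact: measurable_funN.
by apply/funext => t; case: (x t).
Qed.

Lemma scalar_measurableD D x y : scalar_measurable D x ->
  scalar_measurable D y -> scalar_measurable D (fun t => x t + y t).
Proof.
case: k x y => x y /= => [|[xr xi] [yr yi]]; first exact: measurable_funD.
split.
  rewrite [X in measurable_fun D X](_ : _ = fun t =>
    complex.Re (x t) + complex.Re (y t)); first exact: measurable_funD.
  by apply/funext => t; case: (x t) (y t) => [a b] [c e].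
rewrite [X in measurable_fun D X](_ : _ = fun t =>
    complex.Im (x t) + complex.Im (y t)); first exact: measurable_funD.
by apply/funext => t; case: (x t) (y t) => [a b] [c e].
Qed.

Lemma scalar_measurableB D x y : scalar_measurable D x ->
  scalar_measurable D y -> scalar_measurable D (fun t => x t - y t).
Proof.
by move=> mx my; apply: scalar_measurableD => //; exact: scalar_measurableN.
Qed.

Lemma scalar_measurable0 D : scalar_measurable D (fun=> 0 : K).
Proof. by case: k => /=; [|split]; exact: measurable_cst. Qed.

Lemma scalar_measurable_of_real D (f : T -> R) : measurable_fun D f ->
  scalar_measurable D (fun t => of_real k (f t)).
Proof. by case: k => //= mf; split => //; exact: measurable_cst. Qed.

Lemma scalar_measurableS D E x : measurable E -> D `<=` E ->
  scalar_measurable E x -> scalar_measurable D x.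
Proof.
by case: k x => x mE DE => [|[? ?]]; [|split]; apply: (measurable_funS mE DE).
Qed.

Lemma scalar_measurable_patch D x : measurable D -> scalar_measurable D x ->
  scalar_measurable setT (fun t => if t \in D then x t else 0).
Proof.
move=> mD; case: k x => x /= => [/(measurable_restrictT _ mD)//|].
move=> [/(measurable_restrictT _ mD) mr /(measurable_restrictT _ mD) mi].
by split; [move: mr|move: mi]; apply: eq_measurable_fun => t _;
  rewrite patchE; case: ifP.
Qed.

End scalar_measurability.

(** * Convexity of powers and Young's inequality *)

Section real_inequalities.
Context {R : realType}.
Implicit Types a b c p r t u v : R.

Lemma powR_convex p t a b : 1 <= p -> 0 <= t <= 1 -> 0 <= a -> 0 <= b ->
  (t * a + (1 - t) * b) `^ p <= t * a `^ p + (1 - t) * b `^ p.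
Proof.
move=> p1 /andP[t0 t1] a0 b0.
have := @convex_powR R p p1 (Itv01 t0 t1) a b.
rewrite !inE/= !in_itv/= !andbT => /(_ a0 b0).
by rewrite !convRE.
Qed.

(** Young's inequality for the factors v^(r-p) and u^p with the conjugate exponents r/(r-p) and r/p,
    which raise them to v^r and u^r. *)
Lemma young_powR p r u v : 0 < p -> p < r -> 0 <= u -> 0 <= v ->
  v `^ (r - p) * u `^ p <= (r - p) / r * v `^ r + p / r * u `^ r.
Proof.
move=> p0 pr u0 v0.
have r0 : 0 < r := lt_trans p0 pr.
have rp0 : 0 < r - p by rewrite subr_gt0.
have := @conjugate_powR R (v `^ (r - p)) (u `^ p) (r / (r - p)) (r / p)
  (powR_ge0 _ _) (powR_ge0 _ _).
rewrite !divr_gt0// -!powRrM !invf_div => /(_ erefl erefl).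
have -> : (r - p) * (r / (r - p)) = r by field; rewrite gt_eqF.
have -> : p * (r / p) = r by field; rewrite gt_eqF.
rewrite (mulrC (v `^ r)) (mulrC (u `^ r)); apply.
by field; rewrite gt_eqF.
Qed.

End real_inequalities.

(** * Norms as integrals, and the lower bound for an arbitrary method *)

Section recovery_lemmas.
Context {d : measure_display} {T : measurableType d} {R : realType}.
Variables (k : scalar_kind) (mu : {measure set T -> \bar R}).
Local Notation K := (scalar_field R k).
Implicit Types (x y : T -> K) (D : set T).

(** The norm integrates the restricted function over all of [T]. Off [D] its p-th power is 0^p,
    which is 0 because [p != 0]. *)
Lemma Lp_normE (p : R) D x : p != 0 ->
  Lp_norm mu p%:E D x =
  ((\int[mu]_(t in D) (modulus (x t) `^ p)%:E) `^ p^-1)%E.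
Proof.
move=> p0; rewrite /Lp_norm unlock [in RHS]integral_mkcond.
congr (_ `^ _)%E; apply: eq_integral => t _; rewrite !patchE.
case: ifP => _; first by rewrite /= ger0_norm ?modulus_ge0.
by rewrite /= normr0 powR0.
Qed.

(** Positive powers preserve order on [[0, +oo]], infinite integrals included. Norm bounds thus
    become bounds on integrals, which can be added. *)
Lemma Lp_norm_le (p c : R) D x : 0 < p -> 0 <= c ->
  (Lp_norm mu p%:E D x <= c%:E)%E =
  (\int[mu]_(t in D) (modulus (x t) `^ p)%:E <= (c `^ p)%:E)%E.
Proof.
move=> p0 c0; rewrite Lp_normE ?gt_eqF//; set I := (\int[mu]_(t in D) _)%E.
have I0 : (0 <= I)%E by apply: integral_ge0 => t _; rewrite lee_fin powR_ge0.
have pos (z : \bar R) : (0 <= z)%E -> z \in `[0, +oo]%E.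
  by move=> z0; rewrite in_itv/= z0 leey.
apply/idP/idP => H.
- have := gt0_ler_poweR (ltW p0) (pos _ (poweR_ge0 _ _)) _ H.
  rewrite -poweRrM mulVf ?gt_eqF// poweRe1//; apply; exact: pos.
- have pV0 : 0 <= p^-1 by rewrite invr_ge0 ltW.
  have cp0 : (0 <= (c `^ p)%:E)%E by rewrite lee_fin powR_ge0.
  have := gt0_ler_poweR pV0 (pos _ I0) (pos _ cp0) H.
  by rewrite poweR_EFin -powRrM mulfV ?gt_eqF// powRr1.
Qed.

Lemma Lp_norm_lty (p : R) D x : 0 < p ->
  (Lp_norm mu p%:E D x < +oo)%E <->
  (\int[mu]_(t in D) (modulus (x t) `^ p)%:E < +oo)%E.
Proof.
move=> p0; rewrite Lp_normE ?gt_eqF//; split; last exact: poweR_lty.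
by apply: lty_poweRy; rewrite invr_eq0 gt_eqF.
Qed.

Lemma Lp_normN p D x : Lp_norm mu p D (fun t => - x t) = Lp_norm mu p D x.
Proof.
by congr Lnorm; apply/funext => t; rewrite !patchE modulusN.
Qed.

Lemma Lp_norm0 p D : p != 0%E -> Lp_norm mu p D (fun=> 0 : K) = 0%E.
Proof.
move=> p0; rewrite -[RHS](Lnorm0 mu p0); congr Lnorm; apply/funext => t.
by rewrite patchE modulus0; case: ifP.
Qed.

Variables (T0 : set T) (n : nat) (phi : 'I_n -> T -> K).

(** This central symmetry makes [x] and [- x] two competitors for the same data 0 in the lower
    bound. *)
Lemma classWN p r x : classW mu T0 phi p r x ->
  classW mu T0 phi p r (fun t => - x t).
Proof.
have phiN j : Lp_norm mu r setT (fun t => phi j t * - x t) =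
    Lp_norm mu r setT (fun t => phi j t * x t).
  by rewrite -Lp_normN; congr Lp_norm; apply/funext => t; rewrite mulrN opprK.
move=> [[mx [mx0 xlty] phix] phix1]; split; last by move=> j; rewrite phiN.
split; first exact: scalar_measurableN.
- by split; [exact: scalar_measurableN|rewrite Lp_normN].
- by move=> j; rewrite phiN.
Qed.

Variables (psi : T -> K) (delta : R).

(* The data [y = 0] do not separate [x] from [- x], and the two errors sum to
   at least [2 psi x]. *)
Lemma le_optimal_error (p r : \bar R) (q : R) x : p != 0%E -> 1 <= q ->
  scalar_measurable setT psi -> classW mu T0 phi p r x ->
  (Lp_norm mu p T0 x <= delta%:E)%E ->
  (Lp_norm mu q%:E setT (fun t => psi t * x t)%R <=
   optimal_error mu T0 phi psi delta p q%:E r)%E.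
Proof.
move=> p0 q1 mpsi Wx xdelta; apply/ereal_infP => _ [m [mLp _] <-].
have q_gt0 : 0 < q by exact: lt_le_trans q1.
have Lp0 : Lp mu p T0 (fun=> 0 : K).
  by split; [exact: scalar_measurable0|rewrite Lp_norm0// ltry].
have err z : classW mu T0 phi p r z -> (Lp_norm mu p T0 z <= delta%:E)%E ->
    (Lp_norm mu q%:E setT (fun t => psi t * z t - m (fun=> 0) t)%R <=
     method_error mu T0 phi psi delta p q%:E r m)%E.
  move=> Wz zdelta; apply: ereal_sup_ubound; exists z, (fun=> 0); split => //.
  by rewrite (_ : (fun t => _) = z)//; apply/funext => t; rewrite subr0.
have err1 := err _ Wx xdelta.
have := err _ (classWN Wx); rewrite Lp_normN => /(_ xdelta) err2.
(* An infinite error makes the bound trivial, and the value -oo is excluded because the error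
   dominates a norm. *)
case: method_error err1 err2 => [c| |]; last 2 first.
- by move=> _ _; exact: leey.
- by rewrite leeNy_eq => /eqP h; have := Lnorm_ge0 mu q%:E
    ((fun t => (modulus (psi t * x t - m (fun=> 0) t))%:E) \_ setT);
    rewrite -/(Lp_norm _ _ _ _) h.
move=> err1 err2.
have c0 : 0 <= c by rewrite -lee_fin; apply: le_trans err1; exact: Lnorm_ge0.
rewrite (Lp_norm_le _ _ q_gt0 c0) in err1.
rewrite (Lp_norm_le _ _ q_gt0 c0) in err2.
rewrite (Lp_norm_le _ _ q_gt0 c0).
have [[mx _ _] _] := Wx.
have mpsix := scalar_measurableM mpsi mx.
have [mm _] := mLp _ Lp0.
have mpow (z : T -> K) : scalar_measurable setT z ->
    measurable_fun setT (fun t => (modulus (z t) `^ q)%:E).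
  move=> mz; apply/measurable_EFinP.
  by apply: (measurableT_comp (measurable_powR q)); exact: measurable_modulus.
have m1 := mpow _ (scalar_measurableB mpsix mm).
have m2 := mpow _ (scalar_measurableB
  (scalar_measurableM mpsi (scalar_measurableN mx)) mm).
have half0 : (0 : R) <= 2^-1 by rewrite invr_ge0.
(* The intermediate bound is the average of the two error integrals. With [a] and [b] the errors at
   [x] and [- x], psi x = (a - b)/2, so convexity of u^q at weight 1/2 gives the pointwise
   inequality. *)
apply: (@le_trans _ _ (\int[mu]_t
    ((2^-1)%:E * (modulus (psi t * x t - m (fun=> 0) t)%R `^ q)%:E +
     (2^-1)%:E * (modulus (psi t * - x t - m (fun=> 0) t) `^ q)%:E))%E).
  apply: ge0_le_integral => //.
  - by move=> t _; rewrite lee_fin powR_ge0.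
  - exact: mpow.
  - by apply: emeasurable_funD; exact: measurable_funeM.
  move=> t _; rewrite -!EFinM -EFinD lee_fin.
  set a := psi t * x t - _; set b := psi t * - x t - _.
  have ab : modulus (psi t * x t) <= 2^-1 * modulus a + (1 - 2^-1) * modulus b.
    have -> : (1 - 2^-1 : R) = 2^-1 by field.
    rewrite -mulrDr ler_pdivlMl// mulr_natl -modulusMn.
    have -> : (psi t * x t) *+ 2 = a - b by rewrite /a /b; ring.
    by rewrite -(modulusN b) le_modulusD.
  have -> : 2^-1 * modulus b `^ q = (1 - 2^-1) * modulus b `^ q.
    by congr (_ * _); field.
  apply: le_trans (powR_convex q1 _ (modulus_ge0 _) (modulus_ge0 _)).
    apply: ge0_ler_powR => //; rewrite ?nnegrE ?modulus_ge0 ?(ltW q_gt0)//.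
    by rewrite addr_ge0// mulr_ge0 ?modulus_ge0//; lra.
  by apply/andP; split; lra.
rewrite ge0_integralD//; last 4 first.
- by move=> t _; rewrite mule_ge0// lee_fin ?powR_ge0.
- exact: measurable_funeM.
- by move=> t _; rewrite mule_ge0// lee_fin ?powR_ge0.
- exact: measurable_funeM.
rewrite !ge0_integralZl_EFin//; try by move=> t _; rewrite lee_fin powR_ge0.
have -> : (c `^ q)%:E = ((2^-1)%:E * (c `^ q)%:E + (2^-1)%:E * (c `^ q)%:E)%E.
  by rewrite -EFinM -EFinD; congr (_%:E); field.
by apply: leeD; [apply: lee_wpmul2l err1|apply: lee_wpmul2l err2];
  rewrite lee_fin.
Qed.

End recovery_lemmas.

(** * Pointwise identities for [xhat] and pointwise error of [mhat] *)

Section extremal_pointwise.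
Context {d : measure_display} {T : measurableType d} {R : realType}.
Variables (k : scalar_kind) (T0 : set T) (n : nat).
Local Notation K := (scalar_field R k).
Variables (phi : 'I_n -> T -> K) (psi : T -> K) (p r : R).
Variables (lambda0 : R) (lambda : 'I_n -> R).
Hypotheses (p_ge1 : 1 <= p) (p_lt_r : p < r) (lambda0_gt0 : 0 < lambda0).
Hypothesis lambda_ge0 : forall j, 0 <= lambda j.
Local Notation sigma := (sigma_r phi r lambda).
Local Notation xh := (xhat T0 phi psi p r lambda0 lambda).
Local Notation mh := (mhat T0 psi p lambda0).

Let p_gt0 : 0 < p. Proof. exact: lt_le_trans p_ge1. Qed.
Let r_gt0 : 0 < r. Proof. exact: lt_trans p_lt_r. Qed.
Let rBp_gt0 : 0 < r - p. Proof. by rewrite subr_gt0. Qed.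

(* The factor of [sigma^-1] in [xhat]; it is also the weight that [|x|^p]
   keeps in the error bound for [mhat]. *)
Definition excess (t : T) : R :=
  if t \in T0 then Num.max (modulus (psi t) `^ p - lambda0) 0
  else modulus (psi t) `^ p.

Lemma excess_ge0 t : 0 <= excess t.
Proof.
by rewrite /excess; case: ifP => _; rewrite ?powR_ge0// le_max lexx orbT.
Qed.

Lemma sigma_r_ge0 t : 0 <= sigma t.
Proof. by apply: sumr_ge0 => j _; rewrite mulr_ge0 ?powR_ge0. Qed.

(** The power r-p undoes the root in [xhat], whose base is nonnegative; it remains to solve for
    [excess], dividing by sigma. *)
Lemma excessE t : sigma t != 0 -> excess t = r / p * sigma t * xh t `^ (r - p).
Proof.
move=> s0; rewrite /xhat -powRrM mulVf ?gt_eqF// powRr1.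
  by rewrite -/(excess t); field; rewrite s0 !gt_eqF.
by rewrite -/(excess t) !mulr_ge0 ?excess_ge0 ?invr_ge0 ?sigma_r_ge0 ?ltW//.
Qed.

Lemma excess_xhat t : sigma t != 0 ->
  excess t * xh t `^ p = r / p * (sigma t * xh t `^ r).
Proof.
(* The exponents r-p and p add up to r, which is nonzero, so the addition law also holds where
   [xhat] vanishes. *)
move=> s0; rewrite excessE// -!mulrA -powRD ?subrK//.
by rewrite gt_eqF.
Qed.

(** Young's inequality with v = [xhat], multiplied by (r/p) sigma. By [excess_xhat] equality holds
    at u = [xhat], so this step loses nothing at the extremal function. *)
Lemma excess_young t u : sigma t != 0 -> 0 <= u ->
  excess t * u `^ p <=
  (r - p) / p * (sigma t * xh t `^ r) + sigma t * u `^ r.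
Proof.
move=> s0 u0; rewrite excessE//.
have sr0 : 0 <= r / p * sigma t.
  by rewrite mulr_ge0 ?sigma_r_ge0// divr_ge0// ltW.
have xh0 : 0 <= xh t by exact: powR_ge0.
have := ler_wpM2l sr0 (young_powR p_gt0 p_lt_r u0 xh0).
rewrite [leLHS]mulrA.
set P := xh t `^ r; set Q := u `^ r.
have -> : r / p * sigma t * ((r - p) / r * P + p / r * Q) =
    (r - p) / p * (sigma t * P) + sigma t * Q by field; rewrite !gt_eqF.
by [].
Qed.

(** On [T0], either |psi|^p exceeds lambda0 and splits as lambda0 plus [excess], or the positive
    part is 0 and so is [xhat]. Off [T0], [excess] is |psi|^p itself. *)
Lemma psi_xhat t : modulus (psi t) `^ p * xh t `^ p =
  (if t \in T0 then lambda0 * xh t `^ p else 0) + excess t * xh t `^ p.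
Proof.
rewrite /excess /xhat; case: ifP => tT0; last by rewrite add0r.
case: (leP (modulus (psi t) `^ p - lambda0) 0) => _; last by ring.
by rewrite mulr0 powR0 ?invr_eq0 ?gt_eqF// powR0 ?gt_eqF// !mulr0 addr0.
Qed.

(** At a zero of psi the negative power of 0 is 0 by convention, so the minimum there equals the
    default value 0. *)
Lemma alphaE t : alpha T0 psi p lambda0 t =
  if t \in T0 then Num.min 1 (lambda0 * modulus (psi t) `^ (- p)) else 0.
Proof.
rewrite /alpha; case: (eqVneq (psi t) 0) => [->|_]; last by rewrite andbT.
rewrite andbF modulus0 powR0 ?oppr_eq0 ?gt_eqF// mulr0 min_r//.
by case: ifP.
Qed.

Lemma alpha_ge0 t : 0 <= alpha T0 psi p lambda0 t.
Proof.
rewrite alphaE; case: ifP => // _.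
by rewrite le_min ler01 mulr_ge0 ?powR_ge0 ?ltW.
Qed.

Lemma alpha_le1 t : alpha T0 psi p lambda0 t <= 1.
Proof. by rewrite alphaE; case: ifP => // _; rewrite ge_min lexx. Qed.

(** These are the weights that convexity puts on |x - y|^p and |x|^p. If 0 < |psi|^p <= lambda0 then
    alpha = 1 and the excess is 0; if |psi|^p > lambda0 then alpha |psi|^p is exactly lambda0. Where
    psi vanishes, both products and the excess are 0. *)
Lemma alpha_psi t : t \in T0 ->
  modulus (psi t) `^ p * alpha T0 psi p lambda0 t <= lambda0 /\
  modulus (psi t) `^ p * (1 - alpha T0 psi p lambda0 t) = excess t.
Proof.
rewrite alphaE /excess => -> ; rewrite powRN.
have := powR_ge0 (modulus (psi t)) p.
move: (modulus (psi t) `^ p) => A; rewrite le_eqVlt => /predU1P[<-|A0].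
  by rewrite invr0 mulr0 !mul0r sub0r ltW// max_r// oppr_le0 ltW.
have eA : A * (lambda0 / A) = lambda0 by field; rewrite gt_eqF.
case: (leP 1 (lambda0 / A)) => [|/ltW].
  rewrite ler_pdivlMr// mul1r => Al; split; first by rewrite mulr1.
  by rewrite subrr mulr0 max_r// subr_le0.
rewrite ler_pdivrMr// mul1r => lA; split; first by rewrite eA.
by rewrite mulrBr mulr1 eA max_l// subr_ge0.
Qed.

(* Convexity of [u ^ p], applied to
   [x - alpha y = (1 - alpha) x + alpha (x - y)]. *)
Lemma mhat_error (x y : T -> K) t :
  modulus (psi t * x t - mh y t) `^ p <=
  (if t \in T0 then lambda0 * modulus (x t - y t) `^ p else 0) +
  excess t * modulus (x t) `^ p.
Proof.
rewrite /mhat; case: ifPn => tT0; last first.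
  by rewrite subr0 add0r /excess (negbTE tT0) modulusM powRM ?modulus_ge0.
have [wl we] := alpha_psi tT0.
have := alpha_ge0 t; have := alpha_le1 t; move: wl we.
set a := alpha _ _ _ _ _ => wl we a1 a0.
have -> : psi t * x t - of_real k a * psi t * y t =
    psi t * (of_real k a * (x t - y t) + of_real k (1 - a) * x t).
  by rewrite of_realB of_real1; ring.
rewrite modulusM powRM ?modulus_ge0//.
apply: (@le_trans _ _ (modulus (psi t) `^ p *
    (a * modulus (x t - y t) `^ p + (1 - a) * modulus (x t) `^ p))).
  apply: ler_wpM2l; first exact: powR_ge0.
  apply: le_trans (powR_convex p_ge1 _ (modulus_ge0 _) (modulus_ge0 _)).
    apply: ge0_ler_powR; rewrite ?nnegrE ?modulus_ge0 ?(ltW p_gt0)//.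
      by rewrite addr_ge0// mulr_ge0 ?modulus_ge0// subr_ge0.
    apply: le_trans (le_modulusD _ _) _.
    by rewrite !modulusM !modulus_of_real !ger0_norm// subr_ge0.
  by rewrite a0.
by rewrite mulrDr !mulrA we lerD2r ler_wpM2r ?powR_ge0.
Qed.

(** The case x = 0 of [mhat_error]. It serves to show that [mhat] sends L_p(T0) into L_p(T). *)
Lemma mhat_le (y : T -> K) t : modulus (mh y t) `^ p <=
  if t \in T0 then lambda0 * modulus (y t) `^ p else 0.
Proof.
have := mhat_error (fun=> 0) y t.
by rewrite mulr0 !sub0r !modulusN modulus0 powR0 ?gt_eqF// mulr0 addr0.
Qed.

(** * Measurability of [xhat], [alpha] and [mhat] *)

Hypothesis mT0 : measurable T0.
Hypothesis mphi : forall j, scalar_measurable setT (phi j).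
Hypothesis mpsi : scalar_measurable setT psi.

Let measurable_modulus_powR (z : T -> K) a : scalar_measurable setT z ->
  measurable_fun setT (fun t => modulus (z t) `^ a).
Proof.
move=> mz; apply: (measurableT_comp (measurable_powR a)).
exact: measurable_modulus.
Qed.

Let measurable_if_T0 (f g : T -> R) : measurable_fun setT f ->
  measurable_fun setT g ->
  measurable_fun setT (fun t => if t \in T0 then f t else g t).
Proof.
apply: measurable_fun_ifT; apply: (measurable_fun_bool true).
rewrite setTI (_ : _ @^-1` _ = T0)//.
by apply/seteqP; split => t /=; [move/set_mem|move/mem_set].
Qed.

Lemma measurable_sigma_r : measurable_fun setT sigma.
Proof.
apply: measurable_sum => j; apply: measurable_funM => //.
exact: measurable_modulus_powR.
Qed.

Lemma measurable_excess : measurable_fun setT excess.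
Proof.
apply: measurable_if_T0; last exact: measurable_modulus_powR.
apply: measurable_maxr => //; apply: measurable_funB => //.
exact: measurable_modulus_powR.
Qed.

Lemma measurable_xhat : measurable_fun setT xh.
Proof.
apply: (measurableT_comp (measurable_powR _)).
apply: measurable_funM; last exact: measurable_excess.
apply: measurable_funM => //.
(* For nonnegative sigma the inverse is the power -1, including at 0 where both are 0, so
   measurability of powers applies. *)
rewrite [X in measurable_fun _ X](_ : _ = fun t => sigma t `^ (-1)).
  by apply: (measurableT_comp (measurable_powR _)); exact: measurable_sigma_r.
by apply/funext => t; rewrite powR_inv1// sigma_r_ge0.
Qed.

Lemma measurable_alpha : measurable_fun setT (alpha T0 psi p lambda0).
Proof.
rewrite (funext alphaE).
apply: measurable_if_T0 => //; apply: measurable_minr => //.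
by apply: measurable_funM => //; exact: measurable_modulus_powR.
Qed.

Lemma measurable_mhat (y : T -> K) : scalar_measurable T0 y ->
  scalar_measurable setT (mh y).
Proof.
move=> my; apply: scalar_measurable_patch => //.
apply: scalar_measurableM => //.
apply: (scalar_measurableS measurableT (@subsetT _ _)).
apply: scalar_measurableM => //; apply: scalar_measurable_of_real.
exact: measurable_alpha.
Qed.

End extremal_pointwise.

(** The two bounds make [I] finite, so the slackness equation can be expanded in the reals. *)
Lemma slackness_EFin {R : realType} (l c : R) (I : \bar R) :
  (0 <= I)%E -> (I <= c%:E)%E -> (l%:E * (I - c%:E) = 0)%E ->
  (l%:E * I = (l * c)%:E)%E.
Proof.
case: I => //= i _ _ [] /eqP; rewrite mulrBr subr_eq0 => /eqP li.
by rewrite -EFinM li.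
Qed.

(** * Integration of the pointwise relations with complementary slackness *)

Section extremal_integrals.
Context {d : measure_display} {T : measurableType d} {R : realType}.
Variables (k : scalar_kind) (mu : {measure set T -> \bar R}) (T0 : set T).
Variable n : nat.
Local Notation K := (scalar_field R k).
Variables (phi : 'I_n -> T -> K) (psi : T -> K) (delta p r lambda0 : R).
Variable lambda : 'I_n -> R.
Hypothesis mT0 : measurable T0.
Hypothesis mphi : forall j, scalar_measurable setT (phi j).
Hypotheses (mpsi : scalar_measurable setT psi) (delta_gt0 : 0 < delta).
Hypotheses (p_ge1 : 1 <= p) (p_lt_r : p < r) (lambda0_gt0 : 0 < lambda0).
Hypothesis lambda_ge0 : forall j, 0 <= lambda j.
Local Notation sigma := (sigma_r phi r lambda).
Local Notation xh := (xhat T0 phi psi p r lambda0 lambda).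
Local Notation mh := (mhat T0 psi p lambda0).
Hypothesis sigma_neq0 : {ae mu, forall t, sigma t != 0}.
Hypothesis feas0 :
  (\int[mu]_(t in T0) (xh t `^ p)%:E <= (delta `^ p)%:E)%E.
Hypothesis feas : forall j,
  (\int[mu]_t (modulus (phi j t) `^ r * xh t `^ r)%:E <= 1)%E.
Hypothesis slack0 : (lambda0%:E *
  (\int[mu]_(t in T0) (xh t `^ p)%:E - (delta `^ p)%:E) = 0)%E.
Hypothesis slack : forall j, ((lambda j)%:E *
  (\int[mu]_t (modulus (phi j t) `^ r * xh t `^ r)%:E - 1) = 0)%E.

Let p_gt0 : 0 < p. Proof. exact: lt_le_trans p_ge1. Qed.
Let r_gt0 : 0 < r. Proof. exact: lt_trans p_lt_r. Qed.
Let msigma := measurable_sigma_r r lambda mphi.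
Let mxh : measurable_fun setT xh.
Proof. exact: measurable_xhat. Qed.

Let measurable_powR_comp (f : T -> R) a :
  measurable_fun setT f -> measurable_fun setT (fun t => f t `^ a).
Proof. by move=> mf; exact: (measurableT_comp (measurable_powR a)). Qed.

Let C := lambda0 * delta `^ p + r / p * \sum_(j < n) lambda j.

Lemma extremal_value_ge0 : 0 <= C.
Proof.
apply: addr_ge0; first by rewrite mulr_ge0 ?powR_ge0 ?ltW.
by apply: mulr_ge0; [rewrite divr_ge0 ?ltW|exact: sumr_ge0].
Qed.

(** Nonnegativity allows sum and integral to be interchanged without integrability. Taking u =
    [xhat]^r or u = |x|^r brings in the constraint for each phi_j separately. *)
Lemma integral_sigma_r (u : T -> R) : measurable_fun setT u ->
  (forall t, 0 <= u t) ->
  (\int[mu]_t (sigma t * u t)%:E =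
   \sum_(j < n) (lambda j)%:E *
     \int[mu]_t (modulus (phi j t) `^ r * u t)%:E)%E.
Proof.
move=> mu_u u0.
have mf j : measurable_fun setT (fun t => (modulus (phi j t) `^ r * u t)%:E).
  apply/measurable_EFinP; apply: measurable_funM => //.
  by apply: measurable_powR_comp; exact: measurable_modulus.
transitivity (\int[mu]_t (\sum_(j < n)
    (lambda j)%:E * (modulus (phi j t) `^ r * u t)%:E))%E.
  apply: eq_integral => t _; rewrite /sigma_r mulr_suml -sumEFin.
  by apply: eq_bigr => j _; rewrite -EFinM mulrA.
rewrite ge0_integral_sum//.
- apply: eq_bigr => j _; rewrite ge0_integralZl_EFin// => t _.
  by rewrite lee_fin mulr_ge0 ?powR_ge0.
- by move=> j; exact: measurable_funeM.
- move=> j t _; rewrite mule_ge0// lee_fin ?lambda_ge0//.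
  by rewrite mulr_ge0 ?powR_ge0.
Qed.

(** By slackness the j-th constraint integral, once multiplied by lambda_j, may be replaced by 1,
    whether or not that constraint is active. *)
Lemma integral_sigma_xhat :
  (\int[mu]_t (sigma t * xh t `^ r)%:E = (\sum_(j < n) lambda j)%:E)%E.
Proof.
rewrite integral_sigma_r; last 2 first.
- exact: measurable_powR_comp.
- by move=> t; exact: powR_ge0.
rewrite -sumEFin; apply: eq_bigr => j _.
rewrite (slackness_EFin _ (feas j) (slack j)) ?mulr1//.
by apply: integral_ge0 => t _; rewrite lee_fin mulr_ge0 ?powR_ge0.
Qed.

Lemma integral_T0_xhat :
  (\int[mu]_(t in T0) (lambda0 * xh t `^ p)%:E = (lambda0 * delta `^ p)%:E)%E.
Proof.
under eq_integral do rewrite EFinM.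
rewrite ge0_integralZl_EFin// ?ltW//; last 2 first.
- by move=> t _; rewrite lee_fin powR_ge0.
- apply: measurable_funTS; apply/measurable_EFinP.
  exact: measurable_powR_comp.
rewrite (slackness_EFin _ feas0 slack0)//.
by apply: integral_ge0 => t _; rewrite lee_fin powR_ge0.
Qed.

Lemma integral_if_T0 (f : T -> R) :
  (\int[mu]_t (if t \in T0 then f t else 0)%:E = \int[mu]_(t in T0) (f t)%:E)%E.
Proof.
rewrite [RHS]integral_mkcond; apply: eq_integral => t _.
by rewrite patchE; case: ifP.
Qed.

Lemma measurable_T0_extend0 (f : T -> R) : measurable_fun T0 f ->
  measurable_fun setT (fun t => (if t \in T0 then f t else 0)%:E).
Proof.
by move=> mf; apply/measurable_EFinP; exact/(measurable_restrictT _ mT0).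
Qed.

Lemma integral_psi_xhat :
  (\int[mu]_t (modulus (psi t) `^ p * xh t `^ p)%:E = C%:E)%E.
Proof.
have mpsip : measurable_fun setT (fun t => modulus (psi t) `^ p).
  by apply: measurable_powR_comp; exact: measurable_modulus.
have mxT0 : measurable_fun T0 (fun t => lambda0 * xh t `^ p).
  apply: measurable_funTS; apply: measurable_funM => //.
  exact: measurable_powR_comp.
have msx : measurable_fun setT (fun t => (sigma t * xh t `^ r)%:E).
  apply/measurable_EFinP; apply: measurable_funM => //.
  exact: measurable_powR_comp.
have T0_ge0 t : (0 <= (if t \in T0 then lambda0 * xh t `^ p else 0)%:E)%E.
  by rewrite lee_fin; case: ifP => // _; rewrite mulr_ge0 ?powR_ge0 ?ltW.
have sx_ge0 t : (0 <= (sigma t * xh t `^ r)%:E)%E.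
  by rewrite lee_fin mulr_ge0 ?powR_ge0 ?sigma_r_ge0.
have rp0 : 0 <= r / p by rewrite divr_ge0 ?ltW.
transitivity (\int[mu]_t ((if t \in T0 then lambda0 * xh t `^ p else 0)%:E +
    (r / p)%:E * (sigma t * xh t `^ r)%:E))%E.
  (* [psi_xhat] holds everywhere but [excess_xhat] only where sigma is nonzero, so the integrands
     agree almost everywhere. *)
  apply: ge0_ae_eq_integral => //.
  - apply/measurable_EFinP; apply: measurable_funM => //.
    exact: measurable_powR_comp.
  - apply: emeasurable_funD; first exact: measurable_T0_extend0.
    exact: measurable_funeM.
  - by move=> t _; rewrite lee_fin mulr_ge0 ?powR_ge0.
  - by move=> t _; rewrite adde_ge0// mule_ge0.
  - move: sigma_neq0; apply: filterS => t s0 _.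
    by rewrite psi_xhat// excess_xhat// -EFinM -EFinD.
rewrite ge0_integralD//; last 3 first.
- exact: measurable_T0_extend0.
- by move=> t _; rewrite mule_ge0.
- exact: measurable_funeM.
rewrite ge0_integralZl_EFin// integral_if_T0 integral_T0_xhat.
by rewrite integral_sigma_xhat.
Qed.

(** * Admissibility of [xhat] for the lower bound *)

Lemma integral_modulusM_xhat (q : R) D (f : T -> K) : 0 < q ->
  (\int[mu]_(t in D) (modulus (f t * of_real k (xh t)) `^ q)%:E =
   \int[mu]_(t in D) (modulus (f t) `^ q * xh t `^ q)%:E)%E.
Proof.
move=> q0; apply: eq_integral => t _.
rewrite modulusM modulus_of_real ger0_norm ?powR_ge0//.
by rewrite powRM ?modulus_ge0 ?powR_ge0.
Qed.

Lemma modulus_xhat t : modulus (of_real k (xh t)) = xh t.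
Proof. by rewrite modulus_of_real ger0_norm ?powR_ge0. Qed.

Lemma xhat_T0_le :
  (Lp_norm mu p%:E T0 (fun t => of_real k (xh t)) <= delta%:E)%E.
Proof.
rewrite (Lp_norm_le _ _ _ p_gt0 (ltW delta_gt0)).
by under eq_integral do rewrite modulus_xhat.
Qed.

Lemma classW_xhat : classW mu T0 phi p%:E r%:E (fun t => of_real k (xh t)).
Proof.
have mx : scalar_measurable setT (fun t => of_real k (xh t)).
  exact: scalar_measurable_of_real.
have le1 j :
    (Lp_norm mu r%:E setT (fun t => phi j t * of_real k (xh t))%R <= 1)%E.
  rewrite (Lp_norm_le _ _ _ r_gt0 ler01) powR1.
  by rewrite integral_modulusM_xhat.
split => //; split => // [|j]; last exact: le_lt_trans (le1 j) (ltry _).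
split; first exact: (scalar_measurableS measurableT (@subsetT _ _)).
exact: le_lt_trans xhat_T0_le (ltry _).
Qed.

(** * Admissibility and error of [mhat], and the resulting two-sided bound *)

(** Integrating [mhat_le] bounds the p-th power of the norm of the output by lambda0 times that of
    [y] on [T0]. The output depends only on [y] restricted to [T0] because it is 0 elsewhere. *)
Lemma mhat_recovery_method : recovery_method mu T0 p%:E p%:E mh.
Proof.
split=> [y [my ylty]|y1 y2 _ _ y12]; last first.
  apply/funext => t; rewrite /mhat; case: ifPn => // /set_mem tT0.
  by rewrite y12.
have mmh := measurable_mhat lambda0 p_ge1 mT0 mpsi my.
split; first exact: mmh.
move: ylty; rewrite !(Lp_norm_lty _ _ _ p_gt0) => ylty.
have my_ : measurable_fun T0 (fun t => modulus (y t) `^ p).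
  by apply: (measurableT_comp (measurable_powR p)); exact: measurable_modulus.
apply: (@le_lt_trans _ _
    (\int[mu]_t (if t \in T0 then lambda0 * modulus (y t) `^ p else 0)%:E)%E).
  apply: ge0_le_integral => //.
  - by move=> t _; rewrite lee_fin powR_ge0.
  - apply/measurable_EFinP; apply: measurable_powR_comp.
    exact: measurable_modulus.
  - by apply: measurable_T0_extend0; exact: measurable_funM.
  - by move=> t _; rewrite lee_fin mhat_le.
rewrite integral_if_T0; under eq_integral do rewrite EFinM.
rewrite ge0_integralZl_EFin ?ltW//; last 2 first.
- by move=> t _; rewrite lee_fin powR_ge0.
- exact/measurable_EFinP.
by rewrite lte_mul_pinfty// lee_fin ltW.
Qed.

Lemma integral_mhat_error (x y : T -> K) :
  classW mu T0 phi p%:E r%:E x -> scalar_measurable T0 y ->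
  (Lp_norm mu p%:E T0 (fun t => x t - y t)%R <= delta%:E)%E ->
  (\int[mu]_t (modulus (psi t * x t - mh y t) `^ p)%:E <= C%:E)%E.
Proof.
move=> [[mx _ _] phix] my.
rewrite (Lp_norm_le _ _ _ p_gt0 (ltW delta_gt0)) => xy.
have mmh := measurable_mhat lambda0 p_ge1 mT0 mpsi my.
have mmx : measurable_fun setT (fun t => modulus (x t) `^ r).
  by apply: measurable_powR_comp; exact: measurable_modulus.
have mxy : measurable_fun T0 (fun t => modulus (x t - y t) `^ p).
  apply: (measurableT_comp (measurable_powR p)); apply: measurable_modulus.
  apply: scalar_measurableB => //.
  exact: (scalar_measurableS measurableT (@subsetT _ _)).
have msxh : measurable_fun setT (fun t => (sigma t * xh t `^ r)%:E).
  apply/measurable_EFinP; apply: measurable_funM => //.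
  exact: measurable_powR_comp.
have msx : measurable_fun setT (fun t => (sigma t * modulus (x t) `^ r)%:E).
  by apply/measurable_EFinP; apply: measurable_funM.
have mT0xy : measurable_fun setT
    (fun t => (if t \in T0 then lambda0 * modulus (x t - y t) `^ p else 0)%:E).
  by apply: measurable_T0_extend0; exact: measurable_funM.
have T0_ge0 t :
    (0 <= (if t \in T0 then lambda0 * modulus (x t - y t)%R `^ p else 0)%:E)%E.
  by rewrite lee_fin; case: ifP => // _; rewrite mulr_ge0 ?powR_ge0 ?ltW.
have sxh_ge0 t : (0 <= (sigma t * xh t `^ r)%:E)%E.
  by rewrite lee_fin mulr_ge0 ?powR_ge0 ?sigma_r_ge0.
have sx_ge0 t : (0 <= (sigma t * modulus (x t) `^ r)%:E)%E.
  by rewrite lee_fin mulr_ge0 ?powR_ge0 ?sigma_r_ge0.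
have rpp0 : 0 <= (r - p) / p by rewrite divr_ge0 ?subr_ge0 ?ltW.
have mrest : measurable_fun setT (fun t =>
    ((r - p) / p)%:E * (sigma t * xh t `^ r)%:E +
    (sigma t * modulus (x t) `^ r)%:E)%E.
  by apply: emeasurable_funD => //; exact: measurable_funeM.
have rest_ge0 t : (0 <= ((r - p) / p)%:E * (sigma t * xh t `^ r)%:E +
    (sigma t * modulus (x t) `^ r)%:E)%E.
  by rewrite adde_ge0// mule_ge0.
(* The majorant combines [mhat_error] with [excess_young] at u = |x|, hence holds almost everywhere.
   Its three terms are controlled respectively by the data error, the slackness identity for [xhat],
   and the constraints on [x]. *)
apply: (@le_trans _ _ (\int[mu]_t
    ((if t \in T0 then lambda0 * modulus (x t - y t)%R `^ p else 0)%:E +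
     (((r - p) / p)%:E * (sigma t * xh t `^ r)%:E +
      (sigma t * modulus (x t) `^ r)%:E)))%E).
  apply: ae_ge0_le_integral => //.
  - by move=> t _; rewrite lee_fin powR_ge0.
  - apply/measurable_EFinP; apply: measurable_powR_comp.
    apply: measurable_modulus; apply: scalar_measurableB => //.
    exact: scalar_measurableM.
  - by move=> t _; rewrite adde_ge0.
  - exact: emeasurable_funD.
  - move: sigma_neq0; apply: filterS => t s0 _.
    rewrite -EFinM -!EFinD lee_fin.
    apply: (le_trans (mhat_error T0 psi p_ge1 lambda0_gt0 x y t)).
    by rewrite lerD2l; apply: excess_young => //; exact: modulus_ge0.
rewrite ge0_integralD// ge0_integralD//; last 2 first.
- by move=> t _; rewrite mule_ge0.
- exact: measurable_funeM.
rewrite ge0_integralZl_EFin// integral_sigma_xhat integral_if_T0.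
(* The coefficient r/p is split as (r-p)/p + 1 to match the two Young terms. *)
have -> : C%:E = ((lambda0 * delta `^ p)%:E +
    (((r - p) / p)%:E * (\sum_(j < n) lambda j)%:E +
     (\sum_(j < n) lambda j)%:E))%E.
  rewrite -EFinM -!EFinD /C; congr (_%:E); field.
  by rewrite gt_eqF.
apply: leeD; last apply: leeD => //.
  under eq_integral do rewrite EFinM.
  rewrite ge0_integralZl_EFin//; last 3 first.
  - by move=> t _; rewrite lee_fin powR_ge0.
  - exact/measurable_EFinP.
  - exact: ltW.
  by rewrite [leRHS]EFinM lee_wpmul2l// lee_fin ltW.
rewrite integral_sigma_r//; last by move=> t; exact: powR_ge0.
rewrite -sumEFin; apply: lee_sum => j _.
rewrite -[leRHS]mule1 lee_wpmul2l ?lee_fin//.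
have := phix j; rewrite (Lp_norm_le _ _ _ r_gt0 ler01) powR1.
by under eq_integral do rewrite modulusM powRM ?modulus_ge0//.
Qed.

Lemma method_error_mhat :
  (method_error mu T0 phi psi delta p%:E p%:E r%:E mh <= (C `^ p^-1)%:E)%E.
Proof.
apply/ereal_supP => _ [x [y [Wx [my _] xy ->]]].
rewrite (Lp_norm_le _ _ _ p_gt0 (powR_ge0 _ _)) -powRrM mulVf ?gt_eqF//.
rewrite (powRr1 extremal_value_ge0).
exact: integral_mhat_error.
Qed.

Lemma le_optimal_error_xhat :
  ((C `^ p^-1)%:E <= optimal_error mu T0 phi psi delta p%:E p%:E r%:E)%E.
Proof.
have p_neq0 : p%:E != 0%E by rewrite eqe gt_eqF.
apply: le_trans (le_optimal_error p_neq0 p_ge1 mpsi classW_xhat xhat_T0_le).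
rewrite Lp_normE ?gt_eqF// integral_modulusM_xhat// integral_psi_xhat.
by rewrite poweR_EFin.
Qed.

End extremal_integrals.

Theorem theorem3 (d : measure_display) (T : measurableType d) (R : realType)
    (k : scalar_kind) (mu : {measure set T -> \bar R}) (T0 : set T)
    (n : nat) (phi : 'I_n -> T -> scalar_field R k) (psi : T -> scalar_field R k)
    (delta p r lambda0 : R) (lambda : 'I_n -> R)
    (mT0 : measurable T0) (T0_neq0 : T0 !=set0)
    (mphi : forall j, scalar_measurable setT (phi j))
    (mpsi : scalar_measurable setT psi)
    (delta_gt0 : 0 < delta)
    (Lambda_Lp : forall x, calW mu T0 phi p%:E r%:E x ->
       Lp mu p%:E setT (fun t => psi t * x t))
    (p_ge1 : 1 <= p) (p_lt_r : p < r)
    (lambda0_gt0 : 0 < lambda0) (lambda_ge0 : forall j, 0 <= lambda j)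
    (sigma_neq0 : {ae mu, forall t, sigma_r phi r lambda t != 0})
    (feas0 : (\int[mu]_(t in T0)
         (xhat T0 phi psi p r lambda0 lambda t `^ p)%:E <= (delta `^ p)%:E)%E)
    (feas : forall j, (\int[mu]_t
         (modulus (phi j t) `^ r *
          xhat T0 phi psi p r lambda0 lambda t `^ r)%:E <= 1)%E)
    (slack0 : (lambda0%:E *
       (\int[mu]_(t in T0) (xhat T0 phi psi p r lambda0 lambda t `^ p)%:E
        - (delta `^ p)%:E) = 0)%E)
    (slack : forall j, ((lambda j)%:E *
       (\int[mu]_t (modulus (phi j t) `^ r *
          xhat T0 phi psi p r lambda0 lambda t `^ r)%:E - 1) = 0)%E) :
  optimal_error mu T0 phi psi delta p%:E p%:E r%:E =
    ((lambda0 * delta `^ p + r / p * \sum_(j < n) lambda j) `^ p^-1)%:E /\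
  optimal_method mu T0 phi psi delta p%:E p%:E r%:E
    (mhat T0 psi p lambda0).
Proof.
have mhat_method := mhat_recovery_method mu mT0 mpsi p_ge1 lambda0_gt0.
have upper := method_error_mhat mT0 mphi mpsi delta_gt0 p_ge1 p_lt_r
  lambda0_gt0 lambda_ge0 sigma_neq0 feas slack.
have lower := le_optimal_error_xhat mT0 mphi mpsi delta_gt0 p_ge1 p_lt_r
  lambda0_gt0 lambda_ge0 sigma_neq0 feas0 feas slack0 slack.
(* This closes the chain E <= e([mhat]) <= value <= E, so all three quantities coincide, giving both
   the error formula and optimality. *)
have inf_le : (optimal_error mu T0 phi psi delta p%:E p%:E r%:E <=
    method_error mu T0 phi psi delta p%:E p%:E r%:E
      (mhat T0 psi p lambda0))%E.
  by apply: ereal_inf_lbound; exists (mhat T0 psi p lambda0).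
split; first by apply/eqP; rewrite eq_le lower (le_trans inf_le upper).
split=> //; apply/eqP; rewrite eq_le inf_le andbT.
exact: le_trans upper lower.
Qed.
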